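(* Let $G\rightrightarrows M$ be a continuous groupoid and let $(\pi_i,\mathcal H^i,\Delta^i)$, $i=1,2$, be $M$-irreducible continuous unitary representations of $G$. (i) Every equivariant endomorphism $\Psi:\mathcal H^1\to\mathcal H^1$ is equal to a continuous function $\lambda\in C(M)$ times the identity, i.e. $\Psi=\lambda 1_{\mathcal H^1}$. (ii) If $\Phi:\mathcal H^1\to\mathcal H^2$ is a morphism of representations, then for every $m\in M$ the map $\Phi_m:\mathcal H^1_m\to\mathcal H^2_m$ is either an isomorphism or the zero map. (iii) If, furthermore, $\mathrm{Res}_m: M\text{-}\mathrm{IrRep}(G)\to\mathrm{IrRep}(G_m^m)$ is injective for every $m\in M$, then $\mathrm{Hom}_G(\mathcal H^1,\mathcal H^2)$ is a line bundle over $M$ if $(\pi_1,\mathcal H^1,\Delta^1)\simeq(\pi_2,\mathcal H^2,\Delta^2)$, and is $0$ if $(\pi_1,\mathcal H^1,\Delta^1)\not\simeq(\pi_2,\mathcal H^2,\Delta^2)$.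
   Context: $M$ is a locally compact Hausdorff space and $G\rightrightarrows M$ is a continuous (topological) groupoid with source $s$, target $t$; $G_m^m=\{g: s(g)=t(g)=m\}$ is the isotropy group at $m$. Continuous field of Hilbert spaces over $M$: a pair $(\mathcal H,\Delta)$, with Hilbert spaces $\{\mathcal H_m\}_{m\in M}$ and a linear space of sections $\Delta\subset\prod_m\mathcal H_m$ such that (i) $\{\xi(m):\xi\in\Delta\}=\mathcal H_m$ for all $m$; (ii) $m\mapsto\|\xi(m)\|$ is in $C_0(M)$ for all $\xi\in\Delta$; (iii) if $\xi\in\prod_m\mathcal H_m$ and for each $\varepsilon>0$ and $m\in M$ there is $\eta\in\Delta$ with $\|\xi(n)-\eta(n)\|<\varepsilon$ for $n$ in a neighborhood of $m$, then $\xi\in\Delta$. The total space $\mathcal H=\coprod_m\mathcal H_m$, with projection $p$, has the topology with basis $U(\varepsilon,\xi,V)=\{h: p(h)\in V,\ \|h-\xi(p(h))\|<\varepsilon\}$. A continuous unitary representation of $G$ is such a field with unitary operators $\pi(g):\mathcal H_{s(g)}\to\mathcal H_{t(g)}$ with $\pi(1_m)=\mathrm{id}$, $\pi(gg')=\pi(g)\pi(g')$, $\pi(g^{-1})=\pi(g)^{-1}$ and $(g,h)\mapsto\pi(g)h$ continuous on $\{(g,h): s(g)=p(h)\}$. A morphism of representations is a family of linear maps $\Psi_m:\mathcal H^1_m\to\mathcal H^2_m$ with $\Psi\circ\xi\in\Delta^2$ for $\xi\in\Delta^1$, $m\mapsto\|\Psi_m\|$ locally bounded, and $\Psi_{t(g)}\pi_1(g)=\pi_2(g)\Psi_{s(g)}$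 for all $g$ (equivariance). It is an isomorphism if all $\Psi_m$ are isomorphisms and $\Psi(\Delta^1)=\Delta^2$. A representation is $M$-irreducible if its restriction to each isotropy group $G_m^m$ is an irreducible (in particular non-zero) representation on $\mathcal H_m$. $M\text{-}\mathrm{IrRep}(G)$ is the set of isomorphism classes of $M$-irreducible continuous unitary representations of $G$, $\mathrm{IrRep}(G_m^m)$ the set of isomorphism classes of irreducible continuous unitary representations of $G_m^m$, and $\mathrm{Res}_m$ is restriction to $G_m^m$ acting on $\mathcal H_m$. $\mathrm{Hom}_G(\mathcal H^1,\mathcal H^2)$ is regarded as the family over $M$ whose fiber at $m$ is the space of $G_m^m$-equivariant bounded linear maps $\mathcal H^1_m\to\mathcal H^2_m$, whose continuous sections are the morphisms of continuous fields $\mathcal H^1\to\mathcal H^2$ (families of linear maps satisfying the first two conditions above) taking values in these fibers. *)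

(* Defs.v *)
From HB Require Import structures.
From mathcomp Require Import all_boot all_order all_algebra.
From mathcomp Require Import sesquilinear complex.
From mathcomp Require Import all_classical all_reals all_analysis.

Set Implicit Arguments.
Unset Strict Implicit.
Unset Printing Implicit Defensive.

Import Order.TTheory GRing.Theory Num.Def Num.Theory.
Import numFieldNormedType.Exports.

Local Open Scope classical_set_scope.
Local Open Scope ring_scope.

(* The norm of a normed space over R[i] takes its values in R[i], on the
   nonnegative real axis; [hnorm] is the same number in R. *)
Definition hnorm (R : realType) (V : normedModType R[i]) (v : V) : R :=
  complex.Re `|v|.

(* The inner product is linear in its first argument. *)
Record hilbert (R : realType) := Hilbert {
  hilbert_space :> completeNormedModType R[i];
  inner : {dot hilbert_space for (@conjC R[i])};
  inner_norm : forall v, inner v v = `|v| ^+ 2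
}.

Section Operators.
Context {R : realType}.

Definition opnorm {U V : normedModType R[i]} (f : U -> V) : \bar R :=
  ereal_sup [set (hnorm (f v))%:E | v in [set v | hnorm v <= 1]].

Definition bounded_linear {U V : normedModType R[i]} (f : U -> V) : Prop :=
  linear f /\ (opnorm f < +oo)%E.

Definition bounded_iso {U V : normedModType R[i]} (f : U -> V) : Prop :=
  bounded_linear f /\
  exists f' : V -> U, [/\ bounded_linear f', cancel f f' & cancel f' f].

Definition unitary {U V : hilbert R} (f : U -> V) : Prop :=
  [/\ linear f, (forall u v, inner V (f u) (f v) = inner U u v)
    & bijective f].

Definition subspace_set {V : lmodType R[i]} (W : set V) : Prop :=
  W 0 /\ forall (a : R[i]) u v, W u -> W v -> W (a *: u + v).

Definition irreducible {T : Type} {V : hilbert R} (act : T -> V -> V) : Prop :=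
  (exists v : V, v != 0) /\
  forall W : set V, subspace_set W -> closed W ->
    (forall g v, W v -> W (act g v)) -> W = [set 0] \/ W = setT.

End Operators.

(* [gmul g h] is only meaningful when [src g = tgt h]. *)
Record groupoid (M : topologicalType) := Groupoid {
  arrow :> topologicalType;
  src : arrow -> M;
  tgt : arrow -> M;
  gone : M -> arrow;
  ginv : arrow -> arrow;
  gmul : arrow -> arrow -> arrow;
  src_one : forall m, src (gone m) = m;
  tgt_one : forall m, tgt (gone m) = m;
  src_inv : forall g, src (ginv g) = tgt g;
  tgt_inv : forall g, tgt (ginv g) = src g;
  src_mul : forall g h, src g = tgt h -> src (gmul g h) = src h;
  tgt_mul : forall g h, src g = tgt h -> tgt (gmul g h) = tgt g;
  gmulA : forall g h k, src g = tgt h -> src h = tgt k ->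
    gmul g (gmul h k) = gmul (gmul g h) k;
  gmul1g : forall g, gmul (gone (tgt g)) g = g;
  gmulg1 : forall g, gmul g (gone (src g)) = g;
  gmulVg : forall g, gmul (ginv g) g = gone (src g);
  gmulgV : forall g, gmul g (ginv g) = gone (tgt g);
  src_continuous : continuous src;
  tgt_continuous : continuous tgt;
  gone_continuous : continuous gone;
  ginv_continuous : continuous ginv;
  gmul_continuous :
    {within [set p : arrow * arrow | src p.1 = tgt p.2],
      continuous (fun p => gmul p.1 p.2)}
}.

Section Arrows.
Context {M : topologicalType} (G : groupoid M).

(* The space of arrows from x to y, with the topology induced by G. The
   isotropy group at m is [hom m m]. *)
Definition hom (x y : M) := set_type [set g : G | src g = x /\ tgt g = y].

Definition mk_hom x y (g : G) (sg : src g = x) (tg : tgt g = y) : hom x y :=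
  exist _ g (mem_set (conj sg tg)).

Lemma hom_src x y (g : hom x y) : src (val g) = x.
Proof. by case: (set_valP g). Qed.

Lemma hom_tgt x y (g : hom x y) : tgt (val g) = y.
Proof. by case: (set_valP g). Qed.

Lemma hom_composable x y z (g : hom y z) (h : hom x y) :
  src (val g) = tgt (val h).
Proof. by rewrite hom_src hom_tgt. Qed.

Definition hone m : hom m m := mk_hom (src_one G m) (tgt_one G m).

Definition hinv x y (g : hom x y) : hom y x :=
  mk_hom (etrans (src_inv (val g)) (hom_tgt g))
         (etrans (tgt_inv (val g)) (hom_src g)).

Definition hmul x y z (g : hom y z) (h : hom x y) : hom x z :=
  mk_hom (etrans (src_mul (hom_composable g h)) (hom_src h))
         (etrans (tgt_mul (hom_composable g h)) (hom_tgt g)).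

End Arrows.

Definition C0_function (R : realType) (M : topologicalType)
    (f : M -> R) : Prop :=
  continuous f /\
  forall e : R, 0 < e ->
    exists2 K : set M, compact K & forall m, ~ K m -> `|f m| < e.

Record hilbert_field (R : realType) (M : topologicalType) := HilbertField {
  fiber :> M -> hilbert R;
  Delta : set (forall m, fiber m);
  Delta0 : Delta (fun=> 0);
  DeltaP : forall (a : R[i]) xi eta, Delta xi -> Delta eta ->
    Delta (fun m => a *: xi m + eta m);
  Delta_total : forall m (v : fiber m), exists2 xi, Delta xi & xi m = v;
  Delta_norm : forall xi, Delta xi ->
    C0_function (fun m => hnorm (xi m));
  Delta_closed : forall xi : (forall m, fiber m),
    (forall (e : R) (m : M), 0 < e ->
      exists2 eta, Delta eta & \forall n \near m, hnorm (xi n - eta n) < e) ->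
    Delta xi
}.

Section TotalSpace.
Context {R : realType} {M : topologicalType} (H : hilbert_field R M).

(* A record rather than {m : M & H m}, which the library equips with the
   disjoint union topology. *)
Record total := Tot { proj : M; vect : H proj }.

HB.instance Definition _ := gen_eqMixin total.
HB.instance Definition _ := gen_choiceMixin total.

Definition tube (e : R) (xi : forall m, H m) (V : set M) : set total :=
  [set h | V (proj h) /\ hnorm (vect h - xi (proj h)) < e].

Definition tubes : set (set total) :=
  [set W | exists e xi V,
     [/\ 0 < e, Delta xi, open V & W = tube e xi V]].

Lemma hnormE (m : M) (v : H m) : `|v| = (hnorm v)%:C%C.
Proof. by rewrite /hnorm RRe_real// normr_real. Qed.

Lemma hnormD (m : M) (u v : H m) : hnorm (u + v) <= hnorm u + hnorm v.
Proof. by rewrite -lecR rmorphD/= -!hnormE ler_normD. Qed.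

Lemma hnorm0 (m : M) : hnorm (0 : H m) = 0.
Proof. by rewrite /hnorm normr0. Qed.

Lemma hnorm_ball (m : M) (u v : H m) (e : R) :
  ball u e%:C%C v <-> hnorm (v - u) < e.
Proof. by rewrite -ball_normE /ball_/= distrC hnormE ltcR. Qed.

Let tubes_cover : \bigcup_(W in tubes) W = setT.
Proof.
apply/seteqP; split=> // -[m v] _.
have [xi Dxi xim] := Delta_total v.
exists (tube 1 xi setT); first by exists 1, xi, setT; split=> //; exact: openT.
by split=> //=; rewrite xim subrr hnorm0.
Qed.

Let tubes_join (W1 W2 : set total) t : tubes W1 -> tubes W2 -> W1 t -> W2 t ->
  exists W, [/\ tubes W, W t & W `<=` W1 `&` W2].
Proof.
case: t => m v [e1 [xi1 [V1 [e1_gt0 D1 oV1 ->]]]].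
case=> [e2 [xi2 [V2 [e2_gt0 D2 oV2 ->]]]] [/= V1m lt1] [/= V2m lt2].
have [xi Dxi xim] := Delta_total v.
pose f1 n := hnorm (xi n - xi1 n).
pose f2 n := hnorm (xi n - xi2 n).
have Df (eta : forall m, H m) : Delta eta ->
    continuous (fun n => hnorm (xi n - eta n)).
  move=> Deta; have [cf _] := Delta_norm (@DeltaP _ _ H (-1) _ _ Deta Dxi).
  rewrite (_ : (fun n => _) = (fun n => hnorm (-1 *: eta n + xi n)))//.
  by apply/funext => n; rewrite scaleN1r addrC.
pose d : R := Num.min (e1 - f1 m) (e2 - f2 m) / 2.
have d_gt0 : 0 < d by rewrite divr_gt0// lt_min !subr_gt0 /f1 /f2 xim lt1.
have d1 : d + d <= e1 - f1 m by rewrite -splitr ge_min lexx.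
have d2 : d + d <= e2 - f2 m by rewrite -splitr ge_min lexx orbT.
pose V := V1 `&` V2 `&` (f1 @^-1` [set x | x < f1 m + d])
                     `&` (f2 @^-1` [set x | x < f2 m + d]).
exists (tube d xi V); split.
- exists d, xi, V; split=> //; apply: openI; first apply: openI.
  + exact: openI.
  + by apply: open_comp; [move=> x _; exact: Df | exact: open_lt].
  + by apply: open_comp; [move=> x _; exact: Df | exact: open_lt].
- by split; rewrite /V/= ?xim ?subrr ?hnorm0// !ltrDl d_gt0.
- move=> [n w] [/= [[[V1n V2n] /= lt1n] lt2n] ltw]; split; split=> //=.
  + rewrite -(subrK (xi n) w) -addrA (le_lt_trans (hnormD _ _))//.
    rewrite (lt_le_trans (ltrD ltw lt1n))// addrCA -lerBrDl.
    exact: d1.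
  + rewrite -(subrK (xi n) w) -addrA (le_lt_trans (hnormD _ _))//.
    rewrite (lt_le_trans (ltrD ltw lt2n))// addrCA -lerBrDl.
    exact: d2.
Qed.

HB.instance Definition _ := @isBaseTopological.Build total
  (set total) tubes id tubes_cover
  (fun W1 W2 t => @tubes_join W1 W2 t).

Lemma tube_open e xi V : 0 < e -> Delta xi -> open V -> open (tube e xi V).
Proof.
move=> e0 Dxi oV; exists [set tube e xi V]; last by rewrite bigcup_set1.
by move=> _ ->; exists e, xi, V.
Qed.

End TotalSpace.

Section Action.
Context {R : realType} {M : topologicalType} (G : groupoid M).
Context (H : hilbert_field R M).
Variable pi : forall x y, hom G x y -> H x -> H y.

Definition action_dom :=
  set_type [set p : G * total H | src p.1 = proj p.2].

Definition action (p : action_dom) : total H :=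
  Tot (pi (mk_hom (set_valP p) erefl) (vect (val p).2)).

End Action.

Record rep (R : realType) (M : topologicalType) (G : groupoid M) := Rep {
  rep_field :> hilbert_field R M;
  rpi : forall x y, hom G x y -> rep_field x -> rep_field y;
  rpi_unitary : forall x y (g : hom G x y), unitary (rpi g);
  rpi1 : forall m v, rpi (hone G m) v = v;
  rpiM : forall x y z (g : hom G y z) (h : hom G x y) v,
    rpi (hmul g h) v = rpi g (rpi h v);
  rpiVK : forall x y (g : hom G x y), cancel (rpi g) (rpi (hinv g));
  rpiKV : forall x y (g : hom G x y), cancel (rpi (hinv g)) (rpi g);
  rpi_continuous : continuous (action rpi)
}.

Record isotropy_rep (R : realType) (M : topologicalType) (G : groupoid M)
    (m : M) := IsotropyRep {
  irep_space :> hilbert R;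
  ipi : hom G m m -> irep_space -> irep_space;
  ipi_unitary : forall g, unitary (ipi g);
  ipi1 : forall v, ipi (hone G m) v = v;
  ipiM : forall g h v, ipi (hmul g h) v = ipi g (ipi h v);
  ipiVK : forall g, cancel (ipi g) (ipi (hinv g));
  ipiKV : forall g, cancel (ipi (hinv g)) (ipi g);
  ipi_continuous :
    continuous (fun p : hom G m m * irep_space => ipi p.1 p.2)
}.

Arguments rpi {R M G} r {x y} g v.
Arguments ipi {R M G m} i g v.

Section Restriction.
Context {R : realType} {M : topologicalType} (G : groupoid M).
Variables (rho : rep R G) (m : M).

Let Tot_rpi y (g : hom G m y) (v : rho m) :
  Tot (rpi rho (mk_hom (hom_src g) erefl) v) = Tot (rpi rho g v).
Proof.
rewrite [in RHS](_ : g = mk_hom (hom_src g) (hom_tgt g)); last exact/val_inj.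
by move: (val g) (hom_src g) (hom_tgt g) => g0 sg tg; case: _ / tg.
Qed.

Let res_in (p : hom G m m * rho m) : src (val p.1) = proj (Tot p.2).
Proof. exact: hom_src. Qed.

Let res_dom (p : hom G m m * rho m) : action_dom G rho :=
  exist _ (val p.1, Tot p.2) (mem_set (res_in p)).

Let res_actionE p : action (@rpi R M G rho) (res_dom p) = Tot (rpi rho p.1 p.2).
Proof.
rewrite -Tot_rpi /action /=; congr Tot; congr (rpi rho _ _).
exact/val_inj.
Qed.

Let Tot_continuous : continuous (fun v : rho m => Tot v).
Proof.
apply/continuousP => A [D Dtubes <-]; rewrite preimage_bigcup.
apply: bigcup_open => _ /Dtubes [e [xi [V [e0 Dxi oV ->]]]].
have [Vm|Vm] := pselect (V m); last first.
  rewrite (_ : _ @^-1` _ = set0); first exact: open0.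
  by apply/seteqP; split=> v // -[].
rewrite (_ : _ @^-1` _ = ball (xi m) e%:C%C); first exact: ball_open.
by apply/seteqP; split=> v /=; rewrite hnorm_ball// => -[].
Qed.

Let res_dom_continuous : continuous res_dom.
Proof.
apply: continuous_comp_initial => p.
apply: (@cvg_pair _ _ _ _ (nbhs (val p.1)) (nbhs (Tot p.2))).
  apply: continuous_comp; first exact: cvg_fst.
  exact: initial_continuous.
by apply: continuous_comp; [exact: cvg_snd | exact: Tot_continuous].
Qed.

Let res_continuous :
  continuous (fun p : hom G m m * rho m => rpi rho p.1 p.2).
Proof.
move=> p A /nbhs_ballP[e /= e_gt0 eA].
have eE : e = (complex.Re e)%:C%C by rewrite RRe_real ?gtr0_real.
have Re_gt0 : 0 < complex.Re e by rewrite -ltcR -eE.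
have [xi Dxi xiE] := Delta_total (rpi rho p.1 p.2).
have : nbhs (Tot (rpi rho p.1 p.2)) (tube (complex.Re e) xi setT).
  apply: open_nbhs_nbhs; split; first exact: tube_open openT.
  by split=> //=; rewrite xiE subrr hnorm0.
rewrite -res_actionE => /rpi_continuous /res_dom_continuous.
move=> /(@filterS _ (nbhs p)); apply=> q; rewrite /= res_actionE => -[_ /=].
by rewrite xiE -hnorm_ball -eE => /eA.
Qed.

Definition Res : isotropy_rep R G m :=
  IsotropyRep (@rpi_unitary _ _ _ rho m m) (@rpi1 _ _ _ rho m)
    (@rpiM _ _ _ rho m m m) (@rpiVK _ _ _ rho m m) (@rpiKV _ _ _ rho m m)
    res_continuous.

End Restriction.

Section Morphisms.
Context {R : realType} {M : topologicalType} {G : groupoid M}.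

Definition field_morphism (H1 H2 : hilbert_field R M)
    (Psi : forall m, H1 m -> H2 m) : Prop :=
  [/\ forall m, linear (Psi m),
      forall xi, Delta xi -> Delta (fun m => Psi m (xi m))
    & forall m : M, exists c : R,
        \forall n \near m, (opnorm (Psi n) <= c%:E)%E].

Definition equivariant (rho1 rho2 : rep R G)
    (Psi : forall m, rho1 m -> rho2 m) : Prop :=
  forall x y (g : hom G x y) v, Psi y (rpi rho1 g v) = rpi rho2 g (Psi x v).

Definition rep_morphism (rho1 rho2 : rep R G)
    (Psi : forall m, rho1 m -> rho2 m) : Prop :=
  field_morphism Psi /\ equivariant Psi.

Definition rep_iso (rho1 rho2 : rep R G) : Prop :=
  exists Psi : forall m, rho1 m -> rho2 m,
    [/\ rep_morphism Psi, forall m, bounded_iso (Psi m)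
      & [set (fun m => Psi m (xi m)) | xi in @Delta _ _ rho1]
        = @Delta _ _ rho2].

Definition intertwiner m (sigma1 sigma2 : isotropy_rep R G m) :
    set (sigma1 -> sigma2) :=
  [set f | bounded_linear f /\
    forall g v, f (ipi sigma1 g v) = ipi sigma2 g (f v)].

Definition isotropy_rep_iso m (sigma1 sigma2 : isotropy_rep R G m) : Prop :=
  exists2 f : sigma1 -> sigma2, intertwiner f & bounded_iso f.

Definition M_irreducible (rho : rep R G) : Prop :=
  forall m, irreducible (ipi (Res rho m)).

(* Isomorphism classes are handled through the relations [rep_iso] and
   [isotropy_rep_iso]: this is injectivity of the map induced by [Res] at m
   between isomorphism classes of irreducible representations. *)
Definition Res_injective (m : M) : Prop :=
  forall rho1 rho2 : rep R G, M_irreducible rho1 -> M_irreducible rho2 ->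
    isotropy_rep_iso (Res rho1 m) (Res rho2 m) -> rep_iso rho1 rho2.

Definition Hom_fiber (rho1 rho2 : rep R G) (m : M) : set (rho1 m -> rho2 m) :=
  @intertwiner m (Res rho1 m) (Res rho2 m).

Arguments Hom_fiber : clear implicits.

Definition Hom_sections (rho1 rho2 : rep R G) :
    set (forall m, rho1 m -> rho2 m) :=
  [set Psi | field_morphism Psi /\ forall m, Hom_fiber rho1 rho2 m (Psi m)].

End Morphisms.

Arguments Res_injective R {M} G m.
Arguments Hom_fiber {R M G} rho1 rho2 m.
Arguments Hom_sections {R M G} rho1 rho2.

(* A complex line bundle over M, presented by its fibers [E m], linear subspaces
   of ambient spaces [V m], and by its space [Gamma] of continuous sections:
   there is an atlas of fiberwise linear trivializations [phi i] over [U i]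
   (one around each point i) with continuous transition functions, for which
   [Gamma] is the set of continuous sections. In the third clause [s] is the
   frame of the j-th trivialization, so that [fun m => phi i m (s m)] is the
   transition function from j to i. *)
Definition is_line_bundle (R : realType) (M : topologicalType)
    (V : M -> lmodType R[i]) (E : forall m, set (V m))
    (Gamma : set (forall m, V m)) : Prop :=
  (forall m, subspace_set (E m)) /\
  exists (U : M -> set M) (phi : M -> forall m, V m -> R[i]^o),
  [/\ forall i, open (U i) /\ U i i,
      forall i m, U i m ->
        (forall (a : R[i]) u v, E m u -> E m v ->
          phi i m (a *: u + v) = a * phi i m u + phi i m v) /\
        set_bij (E m) setT (phi i m),
      forall i j (s : forall m, V m),
        (forall m, U j m -> E m (s m) /\ phi j m (s m) = 1) ->
        {within U i `&` U j, continuous (fun m => phi i m (s m))}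
    & Gamma = [set s | (forall m, E m (s m)) /\
        forall i, {within U i, continuous (fun m => phi i m (s m))}]].

Definition is_zero_family (R : realType) (M : topologicalType)
    (V : M -> lmodType R[i]) (E : forall m, set (V m)) : Prop :=
  forall m, E m = [set 0].

(* Main.v *)
Require Import Defs.
From mathcomp Require Import all_boot all_order all_algebra.
From mathcomp Require Import sesquilinear complex.
From mathcomp Require Import all_classical all_reals all_analysis.
From mathcomp Require Import ring lra.

Set Implicit Arguments.
Unset Strict Implicit.
Unset Printing Implicit Defensive.

Import Order.TTheory GRing.Theory Num.Theory.
Import numFieldNormedType.Exports.

Local Open Scope classical_set_scope.
Local Open Scope ring_scope.

(* Schur's lemma for unitary representations on Hilbert spaces is proved without
   the spectral theorem. If [A] is a self-adjoint intertwiner with [|A| <= 1],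
   the square root [S] of [A^2], a strong limit of polynomials in [A^2], is
   again an intertwiner, and [(S - A) (S + A) = 0]; by irreducibility [S = A] or
   [S = -A], so [A] is semidefinite. Applied to [A - t], where [t] is a value of
   the quadratic form of [A] at a unit vector, this forces [A = t]. A general
   intertwiner is a combination of two self-adjoint ones, its adjoint coming
   from the Riesz theorem. Between two irreducible representations, [f^* f] and
   [f f^*] are then scalars, so [f] is zero or invertible, and intertwiners are
   unique up to a scalar.
     Over [M], the scalar relating two sections [eta = lambda xi] of Delta is
   continuous where [xi] does not vanish, as [eta - lambda(m) xi] is in Delta.
   Conversely Delta is stable under multiplication by any continuous function,
   bounded or not, since its closure axiom is local. *)

(** * Norms with real values on complex normed spaces *)

Section ComplexNorm.
Context {R : realType}.

Lemma normc_hnorm (V : normedModType R[i]) (v : V) : `|v| = (hnorm v)%:C%C.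
Proof. by rewrite /hnorm RRe_real// normr_real. Qed.

Lemma Re_normc_ge0 (a : R[i]) : 0 <= complex.Re `|a|.
Proof. by rewrite -ler0c RRe_real ?normr_real. Qed.

Context {V : normedModType R[i]}.
Implicit Types (u v w : V).

Lemma hnorm_ge0 v : 0 <= hnorm v.
Proof. by rewrite -ler0c -normc_hnorm. Qed.

Lemma hnorm_eq0 v : (hnorm v == 0) = (v == 0).
Proof. by rewrite -[RHS]normr_eq0 normc_hnorm -(inj_eq (@complexI R)). Qed.

Lemma hnorm_gt0 v : (0 < hnorm v) = (v != 0).
Proof. by rewrite lt_neqAle eq_sym hnorm_eq0 hnorm_ge0 andbT. Qed.

Lemma hnorm_zero : hnorm (0 : V) = 0.
Proof. by apply/eqP; rewrite hnorm_eq0. Qed.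

Lemma ler_hnormD u v : hnorm (u + v) <= hnorm u + hnorm v.
Proof. by rewrite -lecR rmorphD/= -!normc_hnorm ler_normD. Qed.

Lemma hnormZ (a : R[i]) v : hnorm (a *: v) = complex.Re `|a| * hnorm v.
Proof.
apply: (@complexI R); rewrite -normc_hnorm normrZ rmorphM.
congr (_ * _); exact: normc_hnorm.
Qed.

Lemma hnormZr (r : R) v : hnorm (r%:C%C *: v) = `|r| * hnorm v.
Proof. by rewrite hnormZ normc_def/= expr0n addr0 sqrtr_sqr. Qed.

Lemma hnormN v : hnorm (- v) = hnorm v.
Proof. by rewrite /hnorm normrN. Qed.

Lemma hnorm_distC u v : hnorm (u - v) = hnorm (v - u).
Proof. by rewrite /hnorm distrC. Qed.

(** A positive element of [R[i]] is real, so the radii in [R[i]] used for convergence can be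
    replaced by radii in [R]. *)
Lemma cvg_hnormP {T : Type} {F : set_system T} {FF : Filter F} (f : T -> V) l :
  f @ F --> l <-> forall e : R, 0 < e -> \forall x \near F, hnorm (l - f x) < e.
Proof.
split=> [/cvgrPdist_lt fl e e0|fl].
  have /fl : 0 < e%:C%C by rewrite ltcR.
  by apply: filterS => x; rewrite normc_hnorm ltcR.
apply/cvgrPdist_lt => e e0.
have eE : e = (complex.Re e)%:C%C by rewrite RRe_real ?gtr0_real.
have /fl : 0 < complex.Re e by rewrite -ltcR -eE.
by apply: filterS => x; rewrite normc_hnorm eE ltcR.
Qed.

End ComplexNorm.

(** * Bounded linear maps *)

Section BoundedMaps.
Context {R : realType}.
Implicit Types U V W : normedModType R[i].

(** An explicit real constant replaces the extended real supremum [opnorm]; [bounded_linearP] links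
    the two. *)
Definition hbounded {U V} (f : U -> V) : Prop :=
  exists2 C : R, 0 <= C & forall u, hnorm (f u) <= C * hnorm u.

Lemma opnorm_le {U V} (f : U -> V) (C : R) : 0 <= C ->
  (forall u, hnorm (f u) <= C * hnorm u) -> (opnorm f <= C%:E)%E.
Proof.
move=> C0 fC; apply: ge_ereal_sup => _ [u u1 <-]; rewrite lee_fin.
by rewrite (le_trans (fC u))// -[leRHS]mulr1 ler_wpM2l.
Qed.

Lemma linearZ_of {U V} (f : U -> V) : linear f ->
  forall (a : R[i]) u, f (a *: u) = a *: f u.
Proof.
move=> fl a u.
have f0 : f 0 = 0.
  have := fl 1 0 0; rewrite !scale1r addr0 => /eqP.
  by rewrite -subr_eq0 opprD addNKr oppr_eq0 => /eqP.
by have := fl a u 0; rewrite f0 !addr0.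
Qed.

Lemma le_opnorm {U V} (f : U -> V) (C : R) : linear f ->
  (opnorm f <= C%:E)%E -> forall u, hnorm (f u) <= C * hnorm u.
Proof.
move=> fl fC u; have fZ := linearZ_of fl.
have [->|u0] := eqVneq u 0.
  by have := fZ 0 0; rewrite !scale0r => ->; rewrite !hnorm_zero mulr0.
have nu : 0 < hnorm u by rewrite hnorm_gt0.
have : ((hnorm (f ((hnorm u)^-1%:C%C *: u)))%:E <= C%:E)%E.
  apply: le_trans fC; apply: ereal_sup_ubound.
  exists ((hnorm u)^-1%:C%C *: u) => //=.
  by rewrite hnormZr gtr0_norm ?invr_gt0// mulVf// gt_eqF.
by rewrite fZ hnormZr gtr0_norm ?invr_gt0// lee_fin mulrC ler_pdivrMr.
Qed.

Lemma bounded_linearP {U V} (f : U -> V) :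
  bounded_linear f <-> linear f /\ hbounded f.
Proof.
split=> -[fl]; last first.
  by case=> C C0 fC; split=> //; apply: le_lt_trans (opnorm_le C0 fC) (ltry C).
move=> fb; split=> //.
have f0 : (0 <= opnorm f)%E.
  apply: le_trans (_ : ((hnorm (f 0))%:E <= _)%E).
    by rewrite lee_fin hnorm_ge0.
  by apply: ereal_sup_ubound; exists 0 => //=; rewrite hnorm_zero ler01.
have fE : opnorm f = (fine (opnorm f))%:E by rewrite fineK// ge0_fin_numE.
exists (fine (opnorm f)); first exact: fine_ge0.
by apply: le_opnorm => //; rewrite -fE.
Qed.

Lemma linearD_of {U V} (f : U -> V) : linear f -> {morph f : u v / u + v}.
Proof. by move=> fl u v; have := fl 1 u v; rewrite !scale1r. Qed.

Lemma linearB_of {U V} (f : U -> V) : linear f -> {morph f : u v / u - v}.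
Proof.
by move=> fl u v; have := fl (-1) v u; rewrite !scaleN1r !(addrC (- _)).
Qed.

Lemma linear0_of {U V} (f : U -> V) : linear f -> f 0 = 0.
Proof. by move=> /linearZ_of/(_ 0 0); rewrite !scale0r. Qed.

Lemma hbounded_comp {U V W} (f : V -> W) (g : U -> V) :
  hbounded f -> hbounded g -> hbounded (f \o g).
Proof.
move=> [C C0 fC] [D D0 gD]; exists (C * D); first exact: mulr_ge0.
by move=> u; rewrite (le_trans (fC _))// -mulrA ler_wpM2l.
Qed.

Lemma hbounded_continuous {U V} (f : U -> V) :
  linear f -> hbounded f -> continuous f.
Proof.
move=> fl [C C0 fC] u; apply/cvg_hnormP => e e0.
have eC : 0 < e / (C + 1) by rewrite divr_gt0// ltr_wpDl.
have /cvg_hnormP/(_ _ eC) : id @ nbhs u --> u by exact: cvg_id.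
apply: filterS => v uv; rewrite -(linearB_of fl) (le_lt_trans (fC _))//.
rewrite (@le_lt_trans _ _ ((C + 1) * hnorm (u - v)))//.
  by rewrite ler_wpM2r ?hnorm_ge0// lerDl.
by rewrite mulrC -ltr_pdivlMr// ltr_wpDl.
Qed.

(** Irreducibility only speaks of closed invariant subspaces; kernels are the ones it is applied
    to. *)
Lemma closed_kernel {U V} (f : U -> V) :
  linear f -> hbounded f -> closed [set u | f u = 0].
Proof.
move=> fl fb; rewrite (_ : [set _ | _] = f @^-1` [set 0])//.
apply: closed_comp; first by move=> u _; exact: hbounded_continuous.
exact/accessible_closed_set1/hausdorff_accessible/norm_hausdorff.
Qed.

End BoundedMaps.

(** * The underlying real inner product *)

Section RealInner.
Context {R : realType}.

(** The real part is a real inner product with the same norm, and its values can be compared in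
    [R]. *)
Definition rinner {V : hilbert R} (u v : V) : R := complex.Re (inner V u v).

Context {V : hilbert R}.
Implicit Types (u v w : V).

Lemma rinnerDl u v w : rinner (u + v) w = rinner u w + rinner v w.
Proof. by rewrite /rinner linearDl raddfD. Qed.

Lemma innerC u v : inner V v u = (inner V u v)^*%C.
Proof. by rewrite (hermC (inner V)) expr0 mul1r. Qed.

Lemma rinnerC u v : rinner u v = rinner v u.
Proof. by rewrite /rinner innerC; case: (inner _ _ _). Qed.

Lemma rinnerDr u v w : rinner u (v + w) = rinner u v + rinner u w.
Proof. by rewrite rinnerC rinnerDl !(rinnerC u). Qed.

Lemma rinnerZl (a : R[i]) u v :
  rinner (a *: u) v = complex.Re (a * inner V u v).
Proof. by rewrite /rinner linearZl_LR. Qed.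

(** This is what remains of sesquilinearity in the real form; it makes adjoints taken for [rinner]
    complex linear. *)
Lemma rinnerZr_conj (a : R[i]) u v :
  rinner (a *: u) v = rinner u ((a^*)%C *: v).
Proof.
rewrite rinnerZl rinnerC rinnerZl innerC.
by case: a => a b; case: (inner _ _ _) => c d /=; ring.
Qed.

Lemma rinner_rZl (r : R) u v : rinner (r%:C%C *: u) v = r * rinner u v.
Proof. by rewrite rinnerZl /rinner; case: (inner _ _ _) => a b /=; ring. Qed.

Lemma rinner_rZr (r : R) u v : rinner u (r%:C%C *: v) = r * rinner u v.
Proof. by rewrite rinnerC rinner_rZl rinnerC. Qed.

Lemma rinnerNl u v : rinner (- u) v = - rinner u v.
Proof. by rewrite /rinner linearNl raddfN. Qed.

Lemma rinnerNr u v : rinner u (- v) = - rinner u v.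
Proof. by rewrite rinnerC rinnerNl rinnerC. Qed.

Lemma rinnerBl u v w : rinner (u - v) w = rinner u w - rinner v w.
Proof. by rewrite rinnerDl rinnerNl. Qed.

Lemma rinnerBr u v w : rinner u (v - w) = rinner u v - rinner u w.
Proof. by rewrite rinnerDr rinnerNr. Qed.

Lemma rinner0l v : rinner 0 v = 0.
Proof. by rewrite -(subrr (0 : V)) rinnerBl subrr. Qed.

Lemma rinnervv v : rinner v v = hnorm v ^+ 2.
Proof. by rewrite /rinner inner_norm normc_hnorm -rmorphXn. Qed.

Lemma hnormD_sqr u v :
  hnorm (u + v) ^+ 2 = hnorm u ^+ 2 + 2 * rinner u v + hnorm v ^+ 2.
Proof. by rewrite -!rinnervv !(rinnerDl, rinnerDr) (rinnerC v u); ring. Qed.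

Lemma hnormB_sqr u v :
  hnorm (u - v) ^+ 2 = hnorm u ^+ 2 - 2 * rinner u v + hnorm v ^+ 2.
Proof. by rewrite hnormD_sqr hnormN rinnerNr; ring. Qed.

(** The triangle inequality comes with the normed space; squaring it bounds the cross term. *)
Lemma rinner_le u v : rinner u v <= hnorm u * hnorm v.
Proof.
have := ler_hnormD u v; have := hnormD_sqr u v.
have := hnorm_ge0 (u + v); have := hnorm_ge0 u; have := hnorm_ge0 v.
by nra.
Qed.

Lemma rinner_norm_le u v : `|rinner u v| <= hnorm u * hnorm v.
Proof.
rewrite ler_norml rinner_le andbT lerNl -rinnerNl -(hnormN u).
exact: rinner_le.
Qed.

Lemma rinner_eq0 u : (forall v, rinner u v = 0) -> u = 0.
Proof.
move=> /(_ u)/eqP; rewrite rinnervv sqrf_eq0 hnorm_eq0; exact/eqP.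
Qed.

Lemma rinner_inj u v : (forall w, rinner u w = rinner v w) -> u = v.
Proof.
move=> uv; apply/eqP; rewrite -subr_eq0; apply/eqP/rinner_eq0 => w.
by rewrite rinnerBl uv subrr.
Qed.

End RealInner.

(** * Cauchy sequences *)

Section Completeness.
Context {R : realType} {V : completeNormedModType R[i]}.

Lemma hnorm_cauchy_cvg (u : nat -> V) :
  (forall e : R, 0 < e -> exists N, forall m n, (N <= m)%N -> (N <= n)%N ->
     hnorm (u m - u n) < e) -> exists l : V, u @ \oo --> l.
Proof.
move=> uC; suff cu : cvgn u by exists (limn u).
apply/cauchy_cvgP/cauchy_exP => e e0.
have eE : e = (complex.Re e)%:C%C by rewrite RRe_real ?gtr0_real.
have /uC[N uN] : 0 < complex.Re e by rewrite -ltcR -eE.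
exists (u N), N => // n /= Nn.
by rewrite -ball_normE /ball_/= normc_hnorm eE ltcR; exact: uN.
Qed.

End Completeness.

(** * The Riesz representation theorem *)

Section Riesz.
Context {R : realType} {V : hilbert R}.

(* The representing vector minimises [|v|^2 - 2 phi v]; a minimising sequence
   is Cauchy by the parallelogram law. *)
Lemma riesz (phi : V -> R) (C : R) :
  {morph phi : u v / u + v} ->
  (forall (r : R) v, phi (r%:C%C *: v) = r * phi v) ->
  (forall v, `|phi v| <= C * hnorm v) ->
  exists u, forall v, phi v = rinner u v.
Proof.
move=> phiD phiZ phiC.
pose J v := hnorm v ^+ 2 - 2 * phi v.
have J_ge v : - (C ^+ 2) <= J v.
  have := phiC v; rewrite ler_norml => /andP[_ le].
  by rewrite /J; have := sqr_ge0 (hnorm v - C); rewrite sqrrB; lra.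
have infJ : has_inf (range J).
  by split; [exists (J 0), 0 | exists (- C ^+ 2) => _ [v _ <-]; exact: J_ge].
pose d := inf (range J).
have dJ v : d <= J v by apply: ge_inf; [case: infJ | exists v].
have Jmid u v : hnorm (u - v) ^+ 2 <= 2 * (J u + J v) - 4 * d.
  have := dJ (2^-1%:C%C *: (u + v)).
  rewrite /J hnormZr exprMn phiZ phiD ger0_norm ?invr_ge0// hnormD_sqr.
  by rewrite hnormB_sqr; lra.
have ex_v n : exists v, J v < d + n.+1%:R^-1.
  have n0 : (0 : R) < n.+1%:R^-1 by rewrite invr_gt0.
  by have [_ [v _ <-] Jv] := inf_adherent n0 infJ; exists v.
have [v vP] := choice ex_v.
have inv_small (e : R) : 0 < e ->
    exists N, forall n, (N <= n)%N -> n.+1%:R^-1 < e.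
  move=> e0; have := near_infty_natSinv_lt (PosNum e0) => -[N _ NP].
  by exists N => n Nn; exact: NP.
have [l vl] : exists l : V, v @ \oo --> l.
  apply: hnorm_cauchy_cvg => e e0.
  (* If [J (v m)] and [J (v n)] are both within [e ^+ 2 / 4] of [d], then [Jmid] gives a squared
     distance below [e ^+ 2]. *)
  have e4 : 0 < e ^+ 2 / 4 by rewrite divr_gt0// exprn_gt0.
  have [N NP] := inv_small _ e4; exists N => m n Nm Nn.
  have := Jmid (v m) (v n); have := vP m; have := vP n.
  have := NP m Nm; have := NP n Nn.
  move=> h1 h2 h3 h4 h5.
  rewrite -(@ltr_pXn2r _ 2) ?nnegrE ?hnorm_ge0 ?(ltW e0)//.
  move: (n.+1%:R^-1 : R) (m.+1%:R^-1 : R) h1 h2 h3 h4 h5 => p q h1 h2 h3 h4 h5.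
  by lra.
exists l => w.
(* First variation: with [a] the defect and [q = |w|^2], moving [v n] by [- (a / q) w], the optimal
   step, lowers [J] by [a ^+ 2 / q]. As [J (v n)] is within [1 / (n + 1)] of the infimum, the defect
   is small. *)
have key n : (rinner (v n) w - phi w) ^+ 2 <= hnorm w ^+ 2 * n.+1%:R^-1.
  move: (vP n); move: (n.+1%:R^-1 : R) => r vn.
  have [->|w0] := eqVneq w 0.
    have := phiZ 0 0; rewrite scale0r mul0r => ->.
    by rewrite rinnerC rinner0l hnorm_zero subrr expr0n/= mul0r lexx.
  have nw : 0 < hnorm w ^+ 2 by rewrite exprn_gt0// hnorm_gt0.
  set a := rinner (v n) w - phi w; set q := hnorm w ^+ 2 in nw *.
  have := dJ (v n + (- (a / q))%:C%C *: w); move: vn.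
  rewrite /J hnormD_sqr phiD phiZ hnormZr rinner_rZr exprMn.
  rewrite real_normK ?num_real// -/q => h1 h2.
  have : 2 * (a / q) * a - (a / q) ^+ 2 * q < r.
    have aE : forall t, t * a = t * rinner (v n) w - t * phi w.
      by move=> t; rewrite /a; ring.
    by move: h2 (aE (a / q)); move: (a / q) => t; lra.
  rewrite (_ : _ - _ = a ^+ 2 / q); last by field; rewrite gt_eqF.
  by rewrite ltr_pdivrMr// mulrC => /ltW.
apply/eqP; rewrite eq_sym -subr_eq0 -normr_le0; apply/ler_addgt0Pl => e e0.
rewrite addr0.
have w1 : 0 < hnorm w + 1 by rewrite ltr_wpDl// hnorm_ge0.
(* The final estimate is [2 * e' * hnorm w]; the added 1 covers [w = 0]. *)
pose e' := e / (2 * (hnorm w + 1)).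
have e'0 : 0 < e' by rewrite divr_gt0// mulr_gt0.
have e'E : e = e' * (2 * (hnorm w + 1)).
  by rewrite /e' divfK// gt_eqF// mulr_gt0.
have [N NP] := inv_small _ (exprn_gt0 2 e'0).
have /cvg_hnormP/(_ _ e'0)[N' _ N'P] := vl.
pose n := maxn N N'.
have h1 := NP n (leq_maxl _ _); have h2 := N'P n (leq_maxr _ _).
have h3 := key n; have h4 := rinner_norm_le (l - v n) w.
have : rinner l w - phi w = rinner (l - v n) w + (rinner (v n) w - phi w).
  by rewrite rinnerBl; ring.
move=> ->; rewrite (le_trans (ler_normD _ _))//.
have h5 : `|rinner (v n) w - phi w| <= hnorm w * e'.
  rewrite -(@ler_pXn2r _ 2)//; last by rewrite nnegrE mulr_ge0 ?hnorm_ge0// ltW.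
  rewrite real_normK ?num_real// (le_trans h3)// exprMn ler_wpM2l ?sqr_ge0//.
  exact: ltW.
have h6 : hnorm (l - v n) * hnorm w <= e' * hnorm w.
  by rewrite ler_wpM2r ?hnorm_ge0// ltW.
rewrite e'E; have : 0 <= e' by exact: ltW.
lra.
Qed.

End Riesz.

(** * Adjoints of bounded operators *)

Section Adjoint.
Context {R : realType} {U V : hilbert R}.

(** The vector [f' v] represents the bounded functional sending [u] to [rinner v (f u)]. The bound
    [C] passes to [f'] because [|f' v|^2 = rinner v (f (f' v)) <= C |v| |f' v|]. *)
Lemma adjoint_exists (f : U -> V) : linear f -> hbounded f ->
  exists f' : V -> U, [/\ linear f', hbounded f' &
    forall u v, rinner (f' v) u = rinner v (f u)].
Proof.
move=> fl [C C0 fC].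
have ex_f' v : exists u', forall u, rinner v (f u) = rinner u' u.
  apply: (@riesz R U _ (hnorm v * C)) => [u w|r u|u].
  - by rewrite (linearD_of fl) rinnerDr.
  - by rewrite (linearZ_of fl) rinner_rZr.
  - by rewrite (le_trans (rinner_norm_le _ _))// -mulrA ler_wpM2l// hnorm_ge0.
have [f' f'P] := choice ex_f'; exists f'; split=> [a v w||u v].
- apply: rinner_inj => u; rewrite -f'P !rinnerDl !rinnerZr_conj.
  by rewrite -!f'P (linearZ_of fl).
- exists C => // v.
  have := hnorm_ge0 (f' v); rewrite le_eqVlt => /orP[/eqP <-|f'v].
    by rewrite mulr_ge0 ?hnorm_ge0.
  rewrite -(ler_pM2r f'v) -expr2 -rinnervv -f'P.
  rewrite (le_trans (rinner_le _ _))// mulrAC mulrC ler_wpM2r ?hnorm_ge0//.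
- by rewrite f'P.
Qed.

End Adjoint.

(** * Square roots of positive operators by iteration *)

Section SquareRoot.
Context {R : realType} {V : hilbert R}.

(** The recursion is [Y_0 = 0], [Y_(n+1) = (X + Y_n^2) / 2]. A limit [L] satisfies [2 L = X + L^2],
    that is [(1 - L)^2 = 1 - X]. *)
Fixpoint sqrt_iter (X : V -> V) (n : nat) (v : V) : V :=
  if n is n'.+1
  then (2^-1)%:C%C *: (X v + sqrt_iter X n' (sqrt_iter X n' v)) else 0.

(* [sqrt_iter] run on the real number 1 *)
Fixpoint sqrt_major (n : nat) : R :=
  if n is n'.+1 then (1 + sqrt_major n' ^+ 2) / 2 else 0.

Lemma sqrt_major_itv n : 0 <= sqrt_major n <= 1.
Proof.
elim: n => [|n /andP[y0 y1]] /=; first by rewrite lexx ler01.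
by apply/andP; split; nra.
Qed.

(** Each increment is half the square of [sqrt_major n - 1]. *)
Lemma sqrt_major_nd : {homo sqrt_major : m n / (m <= n)%N >-> m <= n}.
Proof.
apply: homo_leq => [//||n /=]; first exact: le_trans.
by have := sqr_ge0 (sqrt_major n - 1); nra.
Qed.

Lemma sqrt_major_cauchy (e : R) : 0 < e -> exists N, forall m n,
  (N <= m)%N -> (N <= n)%N -> `|sqrt_major m - sqrt_major n| < e.
Proof.
move=> e0; have e2 : 0 < e / 2 by rewrite divr_gt0.
have : cvgn sqrt_major.
  apply: nondecreasing_is_cvgn; first exact: sqrt_major_nd.
  by exists 1 => _ [n _ <-]; case/andP: (sqrt_major_itv n).
move=> /cvgrPdist_lt/(_ _ e2)[N _ NP]; exists N => m n /NP/= h1 /NP/= h2.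
rewrite (splitr e) (le_lt_trans (ler_distD (limn sqrt_major) _ _))//.
by rewrite ltrD// distrC.
Qed.

Variable X : V -> V.
Hypotheses (Xl : linear X) (X1 : forall v, hnorm (X v) <= hnorm v).
Local Notation Y := (sqrt_iter X).
Local Notation y := sqrt_major.

Lemma sqrt_iter_linear n : linear (Y n).
Proof.
elim: n => [|n IH] a u v /=; first by rewrite scaler0 addr0.
by rewrite Xl !IH addrACA scalerA (mulrC a) -scalerA -!scalerDr.
Qed.

(** As [X] is a contraction, the scalar recursion dominates the operator recursion term by term. *)
Lemma sqrt_iter_le n v : hnorm (Y n v) <= y n * hnorm v.
Proof.
elim: n v => [|n IH] v /=; first by rewrite hnorm_zero mul0r.
rewrite hnormZr ger0_norm ?invr_ge0//.
have := ler_hnormD (X v) (Y n (Y n v)); have := X1 v.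
have := le_trans (IH (Y n v)) (ler_wpM2l (andP (sqrt_major_itv n)).1 (IH v)).
by lra.
Qed.

(** Every iterate is a polynomial in [X]. *)
Lemma sqrt_iter_comm (T : V -> V) : linear T ->
  (forall v, T (X v) = X (T v)) -> forall n v, T (Y n v) = Y n (T v).
Proof.
move=> Tl TX; elim=> [|n IH] v /=; first exact: linear0_of.
by rewrite (linearZ_of Tl) (linearD_of Tl) TX !IH.
Qed.

Lemma sqrt_iter_commY m n v : Y m (Y n v) = Y n (Y m v).
Proof.
apply: sqrt_iter_comm; first exact: sqrt_iter_linear.
by move=> {}v; rewrite -(sqrt_iter_comm Xl).
Qed.

(* Since the iterates commute, [A^2 - B^2 = (A - B) (A + B)]. *)
Lemma sqrt_iter_dist m k v :
  hnorm (Y (m + k) v - Y m v) <= (y (m + k) - y m) * hnorm v.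
Proof.
elim: m k v => [|m IH] k v.
  by rewrite add0n /= !subr0; exact: sqrt_iter_le.
rewrite addSn /= -scalerBr hnormZr ger0_norm ?invr_ge0//.
have AD := linearD_of (sqrt_iter_linear (m + k)).
have BD := linearD_of (sqrt_iter_linear m).
have BA := sqrt_iter_commY m (m + k).
set A := Y (m + k) in AD BA *; set B := Y m in BD BA *.
have -> : X v + A (A v) - (X v + B (B v)) = A (A v + B v) - B (A v + B v).
  by rewrite AD BD BA opprD addrACA subrr add0r opprD addrA addrK.
have /andP[a0 _] := sqrt_major_itv (m + k).
have /andP[b0 _] := sqrt_major_itv m.
have ab : 0 <= y (m + k) - y m by rewrite subr_ge0 sqrt_major_nd// leq_addr.
have h1 := IH k (A v + B v).
have h2 : hnorm (A v + B v) <= (y (m + k) + y m) * hnorm v.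
  by rewrite (le_trans (ler_hnormD _ _))// mulrDl lerD// sqrt_iter_le.
have h3 := ler_wpM2l ab h2.
by move: h1 h3; rewrite -/A -/B; lra.
Qed.

(** The root of [1 - X] is [S = 1 - L], with [L] the strong limit of the iterates. It is positive
    because [L] is a contraction, and commutation with [X] passes to the limit. *)
Lemma sqrt_exists : exists S : V -> V,
  [/\ linear S, hbounded S, forall v, S (S v) = v - X v,
      forall v, 0 <= rinner (S v) v
    & forall T : V -> V, linear T -> hbounded T ->
        (forall v, T (X v) = X (T v)) -> forall v, T (S v) = S (T v)].
Proof.
have ex_l v : exists l : V, Y n v @[n --> \oo] --> l.
  apply: hnorm_cauchy_cvg => e e0.
  have v1 : 0 < hnorm v + 1 by rewrite ltr_wpDl// hnorm_ge0.
  have [N NP] := sqrt_major_cauchy (divr_gt0 e0 v1); exists N => m n.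
  wlog mn : m n / (m <= n)%N => [hwlog|] Nm Nn.
    have [mn|/ltnW nm] := leqP m n; first exact: hwlog.
    by rewrite hnorm_distC; exact: hwlog.
  rewrite hnorm_distC -(subnKC mn) (le_lt_trans (sqrt_iter_dist _ _ _))//.
  rewrite subnKC// (@le_lt_trans _ _ (`|y n - y m| * (hnorm v + 1)))//.
    by rewrite ler_pM ?hnorm_ge0 ?ler_norm ?lerDl// subr_ge0 sqrt_major_nd.
  by rewrite -ltr_pdivlMr// NP.
have [L LP] := choice ex_l.
have lim_eq (u v : V) (f : nat -> V) : f @ \oo --> u -> f @ \oo --> v -> u = v.
  by apply: cvg_unique; exact: norm_hausdorff.
have Ll : linear L.
  move=> a u v; apply: lim_eq (LP _) _.
  under eq_fun do rewrite sqrt_iter_linear.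
  by apply: cvgD (LP v); exact: cvgZr (LP u).
have L1 v : hnorm (L v) <= hnorm v.
  apply/ler_addgt0Pl => e e0.
  have /cvg_hnormP/(_ _ e0)[N _ /(_ N (leqnn N))/= lt] := LP v.
  have := sqrt_iter_le N v; have /andP[_ yN1] := sqrt_major_itv N.
  have := ler_hnormD (L v - Y N v) (Y N v); rewrite subrK.
  by have := hnorm_ge0 v; nra.
have LE v : L v = (2^-1)%:C%C *: (X v + L (L v)).
  apply: lim_eq (LP v) _; rewrite -cvg_shiftS /=.
  apply: cvgZr; apply: cvgD; first exact: cvg_cst.
  (* The index and the argument vary together; in this splitting the second term tends to 0 because
     every [Y n] is a contraction. *)
  have -> : (fun n => Y n (Y n v)) = (fun n => Y n (L v) - Y n (L v - Y n v)).
    apply/funext => n; rewrite (linearB_of (sqrt_iter_linear n)) opprB.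
    by rewrite addrC subrK.
  rewrite -[L (L v)]subr0; apply: cvgB (LP _) _; apply/cvg_hnormP => e e0.
  have /cvg_hnormP/(_ _ e0) := LP v; apply: filterS => n.
  rewrite sub0r hnormN; apply: le_lt_trans.
  have /andP[_ yn1] := sqrt_major_itv n.
  by rewrite (le_trans (sqrt_iter_le _ _))// ler_piMl// hnorm_ge0.
have Lcomm (T : V -> V) : linear T -> hbounded T ->
    (forall v, T (X v) = X (T v)) -> forall v, T (L v) = L (T v).
  move=> Tl Tb TX v; apply: lim_eq (LP _).
  under [X in X @ _]eq_fun do rewrite -sqrt_iter_comm//.
  apply: (cvg_comp (G := nbhs (L v)) _ _ (LP v)).
  exact: hbounded_continuous.
exists (fun v => v - L v); split.
- by move=> a u v; rewrite Ll scalerBr opprD addrACA.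
- exists 2 => // v; have := ler_hnormD v (- L v); rewrite hnormN.
  by have := L1 v; lra.
- move=> v; rewrite (linearB_of Ll) opprB.
  have : (2%:R)%:C%C *: L v = X v + L (L v).
    by rewrite [in LHS]LE scalerA -rmorphM/= mulfV// rmorph1 scale1r.
  rewrite (_ : 2%:R%:C%C = 1 + 1); last by rewrite rmorphD rmorph1.
  rewrite scalerDl !scale1r => LL.
  rewrite (_ : X v = L v + L v - L (L v)); last by rewrite LL addrK.
  by rewrite !opprB opprD -addrA; congr (_ + _); rewrite addrCA.
- move=> v; rewrite rinnerBl rinnervv subr_ge0.
  by rewrite (le_trans (rinner_le _ _))// expr2 ler_wpM2r// hnorm_ge0.
- by move=> T Tl Tb TX v; rewrite (linearB_of Tl) Lcomm.
Qed.

End SquareRoot.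

(** * Schur's lemma for irreducible unitary actions *)

Section Schur.
Context {R : realType} {T : Type}.

Definition intertwines {U V : hilbert R} (act1 : T -> U -> U)
    (act2 : T -> V -> V) (f : U -> V) : Prop :=
  forall g v, f (act1 g v) = act2 g (f v).

Lemma unitary_rinner {U V : hilbert R} (f : U -> V) : unitary f ->
  forall u v, rinner (f u) (f v) = rinner u v.
Proof. by case=> _ fE _ u v; rewrite /rinner fE. Qed.

Lemma unitary_hnorm {U V : hilbert R} (f : U -> V) : unitary f ->
  forall v, hnorm (f v) = hnorm v.
Proof.
move=> fu v; apply/eqP; rewrite -(@eqrXn2 _ 2) ?hnorm_ge0//.
by rewrite -!rinnervv unitary_rinner.
Qed.

Lemma unitary_hbounded {U V : hilbert R} (f : U -> V) : unitary f -> hbounded f.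
Proof. by move=> fu; exists 1 => // v; rewrite mul1r unitary_hnorm. Qed.

(** Both sides are tested against vectors [act1 g w], which exhaust the space since [act1 g] is
    bijective; unitarity then cancels [g]. *)
Lemma intertwines_adjoint {U V : hilbert R} (act1 : T -> U -> U)
    (act2 : T -> V -> V) (f : U -> V) (f' : V -> U) :
  (forall g, unitary (act1 g)) -> (forall g, unitary (act2 g)) ->
  (forall u v, rinner (f' v) u = rinner v (f u)) ->
  intertwines act1 act2 f -> intertwines act2 act1 f'.
Proof.
move=> u1 u2 f'P fi g v; apply: rinner_inj => w.
have [_ _ [h _ hK]] := u1 g; rewrite -(hK w) f'P fi.
by rewrite (unitary_rinner (u2 g)) (unitary_rinner (u1 g)) f'P.
Qed.

(** The kernel is a closed invariant subspace, hence everything or 0. *)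
Lemma irreducible_kernel {U V : hilbert R} (act1 : T -> U -> U)
    (act2 : T -> V -> V) (f : U -> V) :
  irreducible act1 -> (forall g, unitary (act2 g)) ->
  linear f -> hbounded f -> intertwines act1 act2 f ->
  (forall v, f v = 0) \/ (forall v, f v = 0 -> v = 0).
Proof.
move=> [_ irr] u2 fl fb fi.
have [||g v /= fv|W0|WT] := irr [set v | f v = 0].
- split=> [|a u v /= fu fv]; first exact: linear0_of.
  by rewrite fl fu fv scaler0 addr0.
- exact: closed_kernel.
- by rewrite fi fv; case: (u2 g) => /linear0_of.
- by right=> v fv; have : [set v | f v = 0] v by []; rewrite W0.
- by left=> v; have : [set: U] v by []; rewrite -WT.
Qed.

Context {V : hilbert R} (act : T -> V -> V).
Hypotheses (act_unitary : forall g, unitary (act g)).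
Hypothesis act_irr : irreducible act.

(* With [S] the square root of [A^2], the operators [S - A] and [S + A] commute
   and their product vanishes, so one of them is zero. *)
Lemma intertwiner_semidefinite (A : V -> V) : linear A -> hbounded A ->
  (forall u v, rinner (A u) v = rinner u (A v)) -> intertwines act act A ->
  (forall v, 0 <= rinner (A v) v) \/ (forall v, rinner (A v) v <= 0).
Proof.
move=> Al [C C0 AC] As Ai.
have c0 : 0 < (C + 1)^-1 by rewrite invr_gt0 ltr_wpDl.
(* Rescaling by a positive constant makes [B] a contraction and keeps the sign of the form. *)
pose B v := ((C + 1)^-1)%:C%C *: A v.
have Bl : linear B.
  by move=> a u v; rewrite /B Al scalerDr !scalerA mulrC.
have B1 v : hnorm (B v) <= hnorm v.
  rewrite hnormZr gtr0_norm// mulrC ler_pdivrMr ?ltr_wpDl//.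
  rewrite (le_trans (AC v))// mulrC ler_wpM2l ?hnorm_ge0//.
  by rewrite lerDl.
have Bs u v : rinner (B u) v = rinner u (B v).
  by rewrite rinner_rZl rinner_rZr As.
have Bb : hbounded B by exists 1 => // v; rewrite mul1r.
have Bi : intertwines act act B.
  move=> g v; rewrite /B Ai; have [al _ _] := act_unitary g.
  by rewrite (linearZ_of al).
(* With this choice the root of [1 - X] is a root of [B^2]; the bound on [X] follows from [|X v|^2 =
   |v|^2 - 2 |B v|^2 + |B (B v)|^2]. *)
pose X v := v - B (B v).
have Xl : linear X.
  by move=> a u v; rewrite /X !Bl scalerBr opprD addrACA.
have X1 v : hnorm (X v) <= hnorm v.
  rewrite -(@ler_pXn2r _ 2) ?nnegrE ?hnorm_ge0// hnormB_sqr -Bs rinnervv.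
  have : hnorm (B (B v)) ^+ 2 <= hnorm (B v) ^+ 2.
    by rewrite ler_pXn2r ?nnegrE ?hnorm_ge0.
  by have := sqr_ge0 (hnorm (B v)); lra.
have [S [Sl [D D0 SD] SS S0 Scomm]] := sqrt_exists Xl X1.
have SE v : S (S v) = B (B v) by rewrite SS /X subKr.
have SB v : B (S v) = S (B v).
  by apply: Scomm => // w; rewrite /X (linearB_of Bl).
pose f v := S v - B v.
have fl : linear f.
  by move=> a u v; rewrite /f Sl Bl scalerBr opprD addrACA.
have fb : hbounded f.
  exists (D + 1); first exact: addr_ge0.
  move=> v; rewrite (le_trans (ler_hnormD _ _))// hnormN mulrDl mul1r.
  exact: lerD.
have fi : intertwines act act f.
  move=> g v; have [al _ _] := act_unitary g.
  rewrite /f Bi -Scomm ?(linearB_of al)//.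
    exact: unitary_hbounded.
  by move=> w; rewrite /X (linearB_of al) !Bi.
have AB v : rinner (A v) v = (C + 1) * rinner (B v) v.
  by rewrite rinner_rZl mulrA divff ?mul1r// gt_eqF// ltr_wpDl.
have [f0|f_inj] := irreducible_kernel act_irr act_unitary fl fb fi.
  left=> v; rewrite AB mulr_ge0 ?addr_ge0//.
  by have /eqP := f0 v; rewrite subr_eq0 => /eqP <-.
right=> v; have /eqP : S v + B v = 0.
  apply: f_inj; rewrite /f (linearD_of Sl) (linearD_of Bl) SE SB.
  by rewrite [X in _ - X]addrC subrr.
rewrite addr_eq0 => /eqP SBv; have := S0 v.
by rewrite SBv rinnerNl oppr_ge0 AB => ?; rewrite mulr_ge0_le0// addr_ge0.
Qed.

(** Along the line [v + s B v] the form equals [b s^2 + 2 n s], with [n = |B v|^2]; nonnegativity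
    for all [s] forces [n = 0]. *)
Lemma positive_isotropic (B : V -> V) v : linear B ->
  (forall u w, rinner (B u) w = rinner u (B w)) ->
  (forall u, 0 <= rinner (B u) u) -> rinner (B v) v = 0 -> B v = 0.
Proof.
move=> Bl Bs B0 Bv.
set n := rinner (B v) (B v); set b := rinner (B (B v)) (B v).
have b0 : 0 <= b by exact: B0.
(* The parameter is [s = - n / (b + 1)], with [b + 1] in place of [b] since [b] may vanish; the form
   is then [- n^2 (b + 2) / (b + 1)^2]. *)
have : 0 <= (- (n / (b + 1))) ^+ 2 * b + 2 * (- (n / (b + 1))) * n.
  have := B0 ((- (n / (b + 1)))%:C%C *: B v + v); rewrite Bl.
  rewrite !(rinnerDl, rinnerDr) !(rinner_rZl, rinner_rZr) Bv.
  rewrite (_ : rinner (B (B v)) v = n) -/n -/b; last by rewrite Bs.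
  by rewrite expr2; lra.
have b1 : 0 < b + 1 by rewrite ltr_wpDl.
have -> : (- (n / (b + 1))) ^+ 2 * b + 2 * (- (n / (b + 1))) * n =
          - (n ^+ 2 * (b + 2)) / (b + 1) ^+ 2 by field; rewrite gt_eqF.
rewrite pmulr_lge0 ?invr_gt0 ?exprn_gt0// oppr_ge0 pmulr_lle0; last first.
  by rewrite ltr_wpDl.
move=> n0; have : n ^+ 2 == 0 by rewrite eq_le n0 sqr_ge0.
by rewrite sqrf_eq0 /n rinnervv sqrf_eq0 hnorm_eq0 => /eqP.
Qed.

(** For the Rayleigh quotient [t] at [v], the form of [B = A - t] vanishes at [v]. As [B] is
    semidefinite, [B v = 0]; so [B] is not injective, and irreducibility makes it zero. *)
Lemma selfadjoint_intertwiner_scalar (A : V -> V) : linear A -> hbounded A ->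
  (forall u v, rinner (A u) v = rinner u (A v)) -> intertwines act act A ->
  exists t : R, forall v, A v = t%:C%C *: v.
Proof.
move=> Al [C C0 AC] As Ai; have [[v v0] _] := act_irr.
pose t := rinner (A v) v / rinner v v.
pose B w := A w - t%:C%C *: w.
have Bl : linear B.
  move=> a u w; rewrite /B Al scalerBr scalerDr !scalerA [t%:C%C * a]mulrC.
  by rewrite opprD addrACA.
have Bb : hbounded B.
  exists (C + `|t|); first exact: addr_ge0.
  by move=> w; rewrite (le_trans (ler_hnormD _ _))// hnormN hnormZr mulrDl lerD.
have Bs u w : rinner (B u) w = rinner u (B w).
  by rewrite rinnerBl rinnerBr As rinner_rZl rinner_rZr.
have Bi : intertwines act act B.
  move=> g w; rewrite /B Ai; have [al _ _] := act_unitary g.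
  by rewrite (linearB_of al) (linearZ_of al).
have Bv : rinner (B v) v = 0.
  rewrite rinnerBl rinner_rZl /t divfK ?subrr//.
  by rewrite rinnervv sqrf_eq0 hnorm_eq0.
have Bv0 : B v = 0.
  have [B0|B0] := intertwiner_semidefinite Bl Bb Bs Bi.
    exact: positive_isotropic.
  apply/eqP; rewrite -oppr_eq0; apply/eqP.
  apply: (@positive_isotropic (fun w => - B w)) => [a u w|u w|u|].
  - by rewrite Bl opprD scalerN.
  - by rewrite rinnerNl rinnerNr Bs.
  - by rewrite rinnerNl oppr_ge0.
  - by rewrite rinnerNl Bv oppr0.
have [B0|B_inj] := irreducible_kernel act_irr act_unitary Bl Bb Bi.
  by exists t => w; have /eqP := B0 w; rewrite subr_eq0 => /eqP.
by move: v0; rewrite (B_inj _ Bv0) eqxx.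
Qed.

Lemma schur (f : V -> V) : linear f -> hbounded f -> intertwines act act f ->
  exists c : R[i], forall v, f v = c *: v.
Proof.
move=> fl fb fi; have [f' [f'l f'b f'P]] := adjoint_exists fl fb.
have f'P' u v : rinner (f u) v = rinner u (f' v).
  by rewrite rinnerC -f'P rinnerC.
have f'i : intertwines act act f' by exact: intertwines_adjoint f'P fi.
have [C C0 fC] := fb; have [D D0 fD] := f'b.
have sumb (v : V) : hnorm (f v) + hnorm (f' v) <= (C + D) * hnorm v.
  by rewrite mulrDl lerD.
have [|||g v|s sP] := @selfadjoint_intertwiner_scalar (fun v => f v + f' v).
- by move=> a u v; rewrite fl f'l scalerDr addrACA.
- exists (C + D); first exact: addr_ge0.
  by move=> v; rewrite (le_trans (ler_hnormD _ _)).
- by move=> u v; rewrite rinnerDl rinnerDr f'P f'P' addrC.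
- by have [al _ _] := act_unitary g; rewrite fi f'i (linearD_of al).
have [|||g v|t tP] :=
    @selfadjoint_intertwiner_scalar (fun v => 'i%C *: (f v - f' v)).
- move=> a u v; rewrite fl f'l opprD addrACA -scalerBr scalerDr !scalerA.
  by rewrite mulrC.
- exists (C + D); first exact: addr_ge0.
  move=> v; rewrite hnormZ normc_def/= expr0n/= expr1n add0r sqrtr1 mul1r.
  by rewrite (le_trans (ler_hnormD _ _))// hnormN.
- move=> u v; rewrite rinnerZr_conj.
  rewrite (_ : ('i^*)%C = - 'i%C :> R[i]); last first.
    by apply/eqP; rewrite eq_complex /= oppr0 !eqxx.
  rewrite rinnerBl f'P f'P' -rinnerBr (linearZ_of fl).
  by rewrite (linearZ_of f'l) -scalerBr scaleNr -scalerN opprB.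
- have [al _ _] := act_unitary g.
  by rewrite fi f'i (linearZ_of al) (linearB_of al).
(* From [f + f' = s] and [i (f - f') = t] one gets [2 f = s - i t]. *)
exists (2^-1 * (s%:C%C - 'i%C * t%:C%C)) => v.
have /= tv := tP v; have /= sv := sP v.
have i2 (w : V) : 'i%C *: ('i%C *: w) = - w.
  by rewrite scalerA -expr2 sqr_i scaleN1r.
rewrite -scalerA scalerBl -scalerA -tv -sv i2 opprK.
rewrite addrACA subrr addr0 -[in RHS](scale1r (f v)) -scalerDl scalerA.
by rewrite -[1 + 1]/(2%:R) mulVf ?scale1r// pnatr_eq0.
Qed.

End Schur.

(** Both [f' f = c] and [f f' = c'] are scalar by Schur's lemma. If [c = 0] then
    [|f v|^2 = rinner (f' (f v)) v = 0]. Otherwise evaluating [f f' f] at a nonzero vector gives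
    [c' = c], and [c^-1 f'] is the inverse. *)
Lemma intertwiner_inverse_or_zero {R : realType} {T : Type} {U V : hilbert R}
    (act1 : T -> U -> U) (act2 : T -> V -> V) (f : U -> V) :
  (forall g, unitary (act1 g)) -> (forall g, unitary (act2 g)) ->
  irreducible act1 -> irreducible act2 ->
  linear f -> hbounded f -> intertwines act1 act2 f ->
  (exists f' : V -> U, [/\ linear f', hbounded f', intertwines act2 act1 f',
     cancel f f' & cancel f' f])
  \/ (forall v, f v = 0).
Proof.
move=> u1 u2 irr1 irr2 fl fb fi.
have [f' [f'l f'b f'P]] := adjoint_exists fl fb.
have f'i : intertwines act2 act1 f' by exact: intertwines_adjoint f'P fi.
have [|||c cP] := @schur _ _ _ _ u1 irr1 (f' \o f).
- by move=> a u v /=; rewrite fl f'l.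
- exact: hbounded_comp.
- by move=> g v /=; rewrite fi f'i.
have [|||c' c'P] := @schur _ _ _ _ u2 irr2 (f \o f').
- by move=> a u v /=; rewrite f'l fl.
- exact: hbounded_comp.
- by move=> g v /=; rewrite f'i fi.
have [c0|c0] := eqVneq c 0.
  right=> v; apply/eqP; rewrite -hnorm_eq0 -sqrf_eq0 -rinnervv -f'P.
  by have /= -> := cP v; rewrite c0 scale0r rinner0l.
have [[v v0] _] := irr1.
have fv0 : f v != 0.
  apply: contraNneq v0 => fv; have /= := cP v; rewrite fv (linear0_of f'l).
  by move=> /esym/eqP; rewrite scaler_eq0 (negbTE c0).
have c'E : c' = c.
  apply/eqP; rewrite -subr_eq0; have := c'P (f v); have /= -> := cP v.
  rewrite (linearZ_of fl) => /eqP; rewrite eq_sym -subr_eq0 -scalerBl.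
  by rewrite scaler_eq0 (negbTE fv0) orbF.
left; exists (fun w => c^-1 *: f' w); split=> [a u w|||w|w].
- by rewrite f'l scalerDr !scalerA mulrC.
- have [D D0 f'D] := f'b; exists (complex.Re `|c^-1| * D).
    by rewrite mulr_ge0// Re_normc_ge0.
  by move=> w; rewrite hnormZ -mulrA ler_wpM2l// Re_normc_ge0.
- move=> g w; have [al _ _] := u1 g.
  by rewrite f'i (linearZ_of al).
- by have /= -> := cP w; rewrite scalerA mulVf// scale1r.
- rewrite (linearZ_of fl); have /= -> := c'P w.
  by rewrite c'E scalerA mulVf// scale1r.
Qed.

(** * Continuous sections and scalar functions *)

Section FieldSections.
Context {R : realType} {M : topologicalType} (H : hilbert_field R M).

Lemma Delta_scale_cst (a : R[i]) (xi : forall m, H m) :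
  Delta xi -> Delta (fun m => a *: xi m).
Proof.
move=> Dxi; have := DeltaP a Dxi (Delta0 H).
by congr Delta; apply: functional_extensionality_dep => m; rewrite addr0.
Qed.

(** The section [eta - lambda(m) xi] has norm [|lambda(n) - lambda(m)| |xi(n)|], continuous in [n]
    and zero at [m]; the factor [|xi(n)|] stays above half of [|xi(m)|] near [m]. *)
Lemma section_ratio_continuous (xi eta : forall m, H m) (lambda : M -> R[i]^o)
    (m : M) : Delta xi -> Delta eta -> (forall n, eta n = lambda n *: xi n) ->
  xi m != 0 -> {for m, continuous lambda}.
Proof.
move=> Dxi Deta etaE xim0.
have nxi : 0 < hnorm (xi m) by rewrite hnorm_gt0.
have [cxi _] := Delta_norm Dxi.
pose zeta n := - lambda m *: xi n + eta n.
have zetaE n : zeta n = (lambda n - lambda m) *: xi n.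
  by rewrite /zeta etaE scaleNr scalerBl addrC.
have [czeta _] := Delta_norm (DeltaP (- lambda m) Dxi Deta).
apply/cvg_hnormP => e e0.
have n2 : 0 < hnorm (xi m) / 2 by rewrite divr_gt0.
have e2 : 0 < e * (hnorm (xi m) / 2) by rewrite mulr_gt0.
have /cvgrPdist_lt/(_ _ n2) near1 := cxi m.
have /cvgrPdist_lt/(_ _ e2) near2 := czeta m.
near=> n.
have h1 : hnorm (xi m) / 2 < hnorm (xi n).
  have : `|hnorm (xi m) - hnorm (xi n)| < hnorm (xi m) / 2.
    by near: n; exact: near1.
  by rewrite ltr_norml => /andP[]; lra.
have : `|hnorm (zeta m) - hnorm (zeta n)| < e * (hnorm (xi m) / 2).
  by near: n; exact: near2.
rewrite [zeta m]zetaE subrr scale0r hnorm_zero sub0r normrN.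
rewrite ger0_norm ?hnorm_ge0// zetaE hnormZ => h2.
have e1 : hnorm (lambda m - lambda n) = complex.Re `|lambda n - lambda m|.
  by rewrite hnorm_distC.
rewrite e1 -(ltr_pM2r n2) (le_lt_trans _ h2)// ler_wpM2l ?(ltW h1)//.
by rewrite -e1 hnorm_ge0.
Unshelve. all: by end_near. Qed.

(** Near [m] the product is uniformly close to [lambda(m) xi], a constant multiple of a section in
    Delta. *)
Lemma Delta_scale (lambda : M -> R[i]^o) (xi : forall m, H m) :
  continuous lambda -> Delta xi -> Delta (fun m => lambda m *: xi m).
Proof.
move=> clambda Dxi; apply: Delta_closed => e m e0.
exists (fun n => lambda m *: xi n); first exact: Delta_scale_cst.
have [cxi _] := Delta_norm Dxi.
have x1 : 0 < hnorm (xi m) + 1 by rewrite ltr_wpDl// hnorm_ge0.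
have /cvgrPdist_lt/(_ _ ltr01) near1 := cxi m.
have /cvg_hnormP/(_ _ (divr_gt0 e0 x1)) near2 := clambda m.
near=> n.
have h1 : hnorm (xi n) < hnorm (xi m) + 1.
  have : `|hnorm (xi m) - hnorm (xi n)| < 1 by near: n; exact: near1.
  by rewrite ltr_norml => /andP[]; lra.
have : hnorm (lambda m - lambda n) < e / (hnorm (xi m) + 1).
  by near: n; exact: near2.
rewrite ltr_pdivlMr// -scalerBl hnormZ; apply: le_lt_trans.
by rewrite hnorm_distC ler_wpM2l ?(ltW h1)// Re_normc_ge0.
Unshelve. all: by end_near. Qed.

Lemma section_through_nonzero m : (exists v : H m, v != 0) ->
  exists2 xi : forall n, H n, Delta xi & xi m != 0.
Proof.
by case=> v v0; have [xi Dxi xim] := Delta_total v; exists xi; rewrite ?xim.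
Qed.

End FieldSections.

(** * Fiberwise intertwiners *)

Section Representations.
Context {R : realType} {M : topologicalType} {G : groupoid M}.
Implicit Types rho : rep R G.

Lemma field_morphism_bounded (H1 H2 : hilbert_field R M)
    (Psi : forall m, H1 m -> H2 m) m :
  field_morphism Psi -> linear (Psi m) /\ hbounded (Psi m).
Proof.
move=> [Psil _ /(_ m)[c /nbhs_singleton Psic]]; apply/bounded_linearP.
by split; [exact: Psil|exact: le_lt_trans Psic (ltry c)].
Qed.

Lemma rep_morphism_Hom_fiber rho1 rho2 (Psi : forall m, rho1 m -> rho2 m) m :
  rep_morphism Psi -> Hom_fiber rho1 rho2 m (Psi m).
Proof.
move=> [Psif Psie]; split=> [|g v]; last exact: Psie.
exact/bounded_linearP/field_morphism_bounded.
Qed.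

Lemma Hom_fiber_scalar rho m (f : rho m -> rho m) :
  M_irreducible rho -> Hom_fiber rho rho m f ->
  exists c : R[i], forall v, f v = c *: v.
Proof.
move=> irr [/bounded_linearP[fl fb] fi].
exact: (schur (ipi_unitary (Res rho m)) (irr m) fl fb fi).
Qed.

Lemma Hom_fiber_iso_or_zero rho1 rho2 m (f : rho1 m -> rho2 m) :
  M_irreducible rho1 -> M_irreducible rho2 -> Hom_fiber rho1 rho2 m f ->
  bounded_iso f \/ (forall v, f v = 0).
Proof.
move=> irr1 irr2 [/bounded_linearP[fl fb] fi].
have [[f' [f'l f'b _ fK f'K]]|] := intertwiner_inverse_or_zero
  (ipi_unitary (Res rho1 m)) (ipi_unitary (Res rho2 m))
  (irr1 m) (irr2 m) fl fb fi; last by right.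
left; split; first exact/bounded_linearP.
by exists f'; split=> //; exact/bounded_linearP.
Qed.

(** Composing [f] with the inverse of [theta] gives a self-intertwiner of [rho1 m], a scalar by
    Schur's lemma. *)
Lemma Hom_fiber_multiple rho1 rho2 m (f theta : rho1 m -> rho2 m) :
  M_irreducible rho1 -> M_irreducible rho2 ->
  Hom_fiber rho1 rho2 m theta -> bounded_iso theta ->
  Hom_fiber rho1 rho2 m f -> exists c : R[i], forall v, f v = c *: theta v.
Proof.
move=> irr1 irr2 [/bounded_linearP[tl tb] ti] [_ [t' [t'b tK t'K]]].
move=> [/bounded_linearP[fl fb] fi].
have /bounded_linearP[t'l t'hb] := t'b.
have [|c cP] := @Hom_fiber_scalar rho1 m (t' \o f) irr1.
  split=> [|g v /=].
    apply/bounded_linearP; split; last exact: hbounded_comp.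
    by move=> a u v /=; rewrite fl t'l.
  apply: (can_inj tK); rewrite t'K fi.
  by have /= -> := ti g (t' (f v)); rewrite t'K.
by exists c => v; rewrite -(linearZ_of tl) -cP /= t'K.
Qed.

Lemma Hom_fiber_scale rho1 rho2 m (c : R[i]) (f : rho1 m -> rho2 m) :
  Hom_fiber rho1 rho2 m f -> Hom_fiber rho1 rho2 m (fun v => c *: f v).
Proof.
move=> [/bounded_linearP[fl [C C0 fC]] fi]; split=> [|g v].
  apply/bounded_linearP; split.
    by move=> a u v; rewrite fl scalerDr !scalerA mulrC.
  exists (complex.Re `|c| * C); first by rewrite mulr_ge0// Re_normc_ge0.
  by move=> v; rewrite hnormZ -mulrA ler_wpM2l// Re_normc_ge0.
have [al _ _] := ipi_unitary (Res rho2 m) g.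
by rewrite fi (linearZ_of al).
Qed.

Lemma Hom_fiber_subspace rho1 rho2 m : subspace_set (Hom_fiber rho1 rho2 m).
Proof.
split.
  split=> [|g v]; last first.
    by have [al _ _] := ipi_unitary (Res rho2 m) g; rewrite (linear0_of al).
  apply/bounded_linearP; split; first by move=> a u v; rewrite scaler0 addr0.
  by exists 0 => // v; rewrite hnorm_zero mul0r.
move=> a u v /(Hom_fiber_scale a)[/bounded_linearP[ul [C C0 uC]] ui].
move=> [/bounded_linearP[vl [D D0 vD]] vi].
have E w : (a *: u + v) w = a *: u w + v w by [].
split=> [|g w].
  apply/bounded_linearP; split=> [b x y|].
    by rewrite !E ul vl addrACA -scalerDr.
  exists (C + D) => [|w]; first exact: addr_ge0.
  rewrite E (le_trans (ler_hnormD _ _))// mulrDl lerD//; exact: uC.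
have [al _ _] := ipi_unitary (Res rho2 m) g.
by rewrite !E (linearD_of al) -ui -vi.
Qed.

End Representations.

(** * The line bundle of intertwiners *)

Section LineBundle.
Context {R : realType} {M : topologicalType}.

Lemma field_morphism_scale (H1 H2 : hilbert_field R M)
    (Psi : forall m, H1 m -> H2 m) (lambda : M -> R[i]^o) :
  field_morphism Psi -> continuous lambda ->
  field_morphism (fun m v => lambda m *: Psi m v).
Proof.
move=> [Psil PsiD Psib] clambda; split=> [m a u v|xi Dxi|m].
- by rewrite Psil scalerDr !scalerA mulrC.
- exact: Delta_scale clambda (PsiD _ Dxi).
- have [c Psic] := Psib m.
  (* The first factor bounds [lambda] near [m]; the maximum with 0 makes the second visibly
     nonnegative, as [opnorm_le] requires. *)
  exists ((hnorm (lambda m) + 1) * Num.max c 0).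
  have /cvg_hnormP/(_ _ ltr01) near1 := clambda m.
  near=> n.
  have c0 : 0 <= Num.max c 0 by rewrite le_max lexx orbT.
  have ln : complex.Re `|lambda n| <= hnorm (lambda m) + 1.
    have h1 : hnorm (lambda m - lambda n) < 1 by near: n; exact: near1.
    have := ler_hnormD (lambda n - lambda m) (lambda m).
    by rewrite subrK hnorm_distC -/(hnorm (lambda n)); lra.
  have Pn : (opnorm (Psi n) <= (Num.max c 0)%:E)%E.
    apply: (@le_trans _ _ c%:E); last by rewrite lee_fin le_max lexx.
    by near: n; exact: Psic.
  apply: opnorm_le => [|u]; first by rewrite mulr_ge0// addr_ge0// hnorm_ge0.
  rewrite hnormZ -mulrA ler_pM ?Re_normc_ge0 ?hnorm_ge0//.
  exact: (le_opnorm (Psil n) Pn).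
Unshelve. all: by end_near. Qed.

Context {G : groupoid M}.

(* [theta] trivialises the bundle globally: the coordinate of an intertwiner is
   its ratio to [theta m]. *)
Lemma Hom_line_bundle (rho1 rho2 : rep R G) :
  M_irreducible rho1 -> M_irreducible rho2 -> rep_iso rho1 rho2 ->
  is_line_bundle (Hom_fiber rho1 rho2) (Hom_sections rho1 rho2).
Proof.
move=> irr1 irr2 [theta [thetam theta_iso _]].
have theta_fiber m := rep_morphism_Hom_fiber m thetam.
have theta_neq0 m (v : rho1 m) : v != 0 -> theta m v != 0.
  have [[tl _] [t' [_ tK _]]] := theta_iso m.
  by rewrite -(inj_eq (can_inj tK)) (linear0_of tl).
(* The vectors [e m] are chosen independently at each point. Continuity of coordinates will come
   from ratios of sections, not from this formula. *)
pose e m := sval (cid (irr1 m).1).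
have e0 m : e m != 0 by rewrite /e; case: cid.
pose q m := inner (rho2 m) (theta m (e m)) (theta m (e m)).
have q0 m : q m != 0.
  by rewrite /q inner_norm expf_neq0// normr_eq0; exact: theta_neq0 (e0 m).
pose phi m (f : rho1 m -> rho2 m) : R[i]^o :=
  inner (rho2 m) (f (e m)) (theta m (e m)) / q m.
have phi_eq m f c : (forall v, f v = c *: theta m v) -> phi m f = c.
  by move=> fE; rewrite /phi fE linearZl_LR/= -/(q m) mulfK.
have fiber_phi m f : Hom_fiber rho1 rho2 m f ->
    forall v, f v = phi m f *: theta m v.
  move=> /(Hom_fiber_multiple irr1 irr2 (theta_fiber m) (theta_iso m))[c cP] v.
  by rewrite (phi_eq _ _ _ cP).
split=> [m|]; first exact: Hom_fiber_subspace.
exists (fun=> setT), (fun=> phi); split=> [i|i m _|i j s sP|].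
- by split=> //; exact: openT.
- split=> [a u v _ _|].
    rewrite /phi (_ : (a *: u + v) (e m) = a *: u (e m) + v (e m))//.
    by rewrite linearDl linearZl_LR/= mulrDl mulrA.
  split=> [//|f g /set_mem Ef /set_mem Eg fg|c _].
    by apply/funext => v; rewrite (fiber_phi _ _ Ef) (fiber_phi _ _ Eg) fg.
  exists (fun v => c *: theta m v); first exact: Hom_fiber_scale.
  exact: phi_eq.
(* All charts coincide, so every transition function is constantly 1. *)
- apply: continuous_subspaceT.
  rewrite (_ : (fun m => _) = fun=> 1); first exact: cst_continuous.
  by apply/funext => m; have [] := sP m I.
- apply/seteqP; split=> s /=.
    move=> [sm sE]; split=> // _; apply: continuous_subspaceT => m.
    (* The coordinate of [s] is the ratio of the sections [s xi] and [theta xi], the latter nonzero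
       at [m]. *)
    have [xi Dxi xim] := section_through_nonzero (irr1 m).1.
    have [_ thetaD _] := thetam.1; have [_ sD _] := sm.
    apply: (section_ratio_continuous (lambda := fun n => phi n (s n))
      (thetaD _ Dxi) (sD _ Dxi)); last exact: theta_neq0.
    by move=> n; exact: fiber_phi.
  move=> [sE s_cont]; split=> //.
  have sc : continuous (fun m => phi m (s m)).
    by move=> m; exact: ((continuous_subspace_setT _).2 (s_cont m) m).
  (* Conversely, [s] is the morphism [theta] times its continuous coordinate. *)
  rewrite (_ : s = fun m v => phi m (s m) *: theta m v).
    exact: field_morphism_scale thetam.1 sc.
  apply: functional_extensionality_dep => m; apply/funext => v.
  exact: fiber_phi.
Qed.

End LineBundle.

(** * Schur's lemma for [M]-irreducible representations of a groupoid *)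

Theorem lemma3p12 (R : realType) (M : topologicalType)
    (M_locally_compact : locally_compact [set: M])
    (M_hausdorff : hausdorff_space M)
    (G : groupoid M) (rho1 rho2 : rep R G)
    (irr1 : M_irreducible rho1) (irr2 : M_irreducible rho2) :
  [/\ (forall Psi : forall m, rho1 m -> rho1 m, rep_morphism Psi ->
         exists2 lambda : M -> R[i]^o, continuous lambda &
           forall m v, Psi m v = lambda m *: v),
      (forall Phi : forall m, rho1 m -> rho2 m, rep_morphism Phi ->
         forall m, bounded_iso (Phi m) \/ (forall v, Phi m v = 0))
    & ((forall m, Res_injective R G m) ->
         (rep_iso rho1 rho2 ->
            is_line_bundle (Hom_fiber rho1 rho2) (Hom_sections rho1 rho2)) /\
         (~ rep_iso rho1 rho2 ->
            is_zero_family (Hom_fiber rho1 rho2)))].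
Proof.
split=> [Psi Psim|Phi Phim m|Res_inj].
(* The scalars are first chosen pointwise; continuity at [m] follows by comparing [xi] and [Psi xi]
   for a section [xi] nonzero at [m]. *)
- have [lambda lambdaP] := choice (fun m =>
    Hom_fiber_scalar irr1 (rep_morphism_Hom_fiber m Psim)).
  exists lambda => // m.
  have [xi Dxi xim] := section_through_nonzero (irr1 m).1.
  have [_ PsiD _] := Psim.1.
  apply: (section_ratio_continuous Dxi (PsiD _ Dxi)) => // n.
- exact: Hom_fiber_iso_or_zero irr1 irr2 (rep_morphism_Hom_fiber m Phim).
- split=> [iso|niso m]; first exact: Hom_line_bundle.
  apply/seteqP; split=> [f fm|_ ->]; last first.
    exact: (Hom_fiber_subspace rho1 rho2 m).1.
  (* An invertible intertwiner at the single point [m] would, by injectivity of restriction, make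
     the two representations isomorphic. *)
  have [fiso|f0] := Hom_fiber_iso_or_zero irr1 irr2 fm.
    by case: niso; apply: (Res_inj m) => //; exists f.
  by apply/funext => v; exact: f0.
Qed.
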